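(* Let $I_1,I_2\subset\mathbf{R}$ be open intervals, let $\gamma=(\gamma_1,\gamma_2):I_1\to S^3$ be a unit speed Legendre curve in $S^3$ and $\alpha=(\alpha_1,\alpha_2):I_2\to H^3_1$ a unit speed Legendre curve in $H^3_1$, such that the map $$\phi:I_2\times I_1\to\mathbf{C}^2,\qquad \phi(t,s)=(\alpha_1(t)\gamma_1(s),\,\alpha_2(t)\gamma_2(s)),$$ is a (Lagrangian conformal) immersion. Then $\phi$ is minimal if and only if the Legendre curves $\gamma$ and $\alpha$ are geodesics in $S^3$ and $H^3_1$, respectively.
   Context: Curves are smooth. $S^3=\{(z,w)\in\mathbf{C}^2:|z|^2+|w|^2=1\}$ with the metric induced from $\mathrm{Re}(z_1\bar w_1+z_2\bar w_2)$. A unit speed Legendre curve $\gamma$ in $S^3$ satisfies $|\gamma_1|^2+|\gamma_2|^2=1$, $|\gamma_1'|^2+|\gamma_2'|^2=1$, $\gamma_1'\bar\gamma_1+\gamma_2'\bar\gamma_2=0$. $H^3_1=\{(z,w)\in\mathbf{C}^2:|z|^2-|w|^2=-1\}$ with the Lorentzian metric induced from $\mathrm{Re}(z_1\bar w_1-z_2\bar w_2)$. A unit speed Legendre curve $\alpha$ in $H^3_1$ satisfies $|\alpha_1|^2-|\alpha_2|^2=-1$, $|\alpha_1'|^2-|\alpha_2'|^2=1$, $\alpha_1'\bar\alpha_1-\alpha_2'\bar\alpha_2=0$. The metric induced by $\phi$ from the Euclidean metric is $(|\gamma_1|^2+|\alpha_1|^2)(dt^2+ds^2)$, so $\phi$ is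 an immersion exactly when $|\gamma_1(s)|^2+|\alpha_1(t)|^2\neq0$ everywhere. $\phi$ is minimal if its mean curvature vector $H=\frac12\mathrm{trace}\,\sigma$ ($\sigma$ the second fundamental form) vanishes identically. *)

(* Defs.v *)
From Stdlib Require Import Reals List.
From Coquelicot Require Import Coquelicot.
Open Scope R_scope.

(* C^2 as a real normed module. *)
Definition C2 : NormedModule R_AbsRing :=
  prod_NormedModule R_AbsRing C_R_NormedModule C_R_NormedModule.

Definition plane : NormedModule R_AbsRing :=
  prod_NormedModule R_AbsRing R_NormedModule R_NormedModule.

(* The two Hermitian forms on C^2; their real parts are the Euclidean metric
   and the metric of signature (2,2). *)
Definition herm_E (z w : C2) : C :=
  Cplus (Cmult (fst z) (Cconj (fst w))) (Cmult (snd z) (Cconj (snd w))).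

Definition herm_L (z w : C2) : C :=
  Cminus (Cmult (fst z) (Cconj (fst w))) (Cmult (snd z) (Cconj (snd w))).

Definition S3 (z : C2) : Prop := Cmod (fst z) ^ 2 + Cmod (snd z) ^ 2 = 1.

Definition H31 (z : C2) : Prop := Cmod (fst z) ^ 2 - Cmod (snd z) ^ 2 = - 1.

Definition Rbar_open_interval (a b : Rbar) (x : R) : Prop := Rbar_lt a x /\ Rbar_lt x b.

(* Derivative of a C-valued, then of a C^2-valued, function of a real variable.
   As with [Derive], the value is meaningful only where the function is
   differentiable. *)
Definition C_Derive (f : R -> C) (x : R) : C :=
  (Derive (fun y => Re (f y)) x, Derive (fun y => Im (f y)) x).

Definition C2_Derive (f : R -> C2) (x : R) : C2 :=
  (C_Derive (fun y => fst (f y)) x, C_Derive (fun y => snd (f y)) x).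

(* Curves are total functions; only their values on the open set [I] matter. *)
Definition smooth_curve_on (I : R -> Prop) (c : R -> C2) : Prop :=
  forall (n : nat) (x : R), I x -> ex_derive (Nat.iter n C2_Derive c) x.

(* [h] is the ambient Hermitian form and [M] the quadric; the Legendre condition
   says that the velocity is h-orthogonal to the position over C. *)
Definition unit_speed_Legendre (h : C2 -> C2 -> C) (M : C2 -> Prop)
    (I : R -> Prop) (c : R -> C2) : Prop :=
  smooth_curve_on I c /\
  forall x : R, I x ->
    M (c x) /\
    Re (h (C2_Derive c x) (C2_Derive c x)) = 1 /\
    h (C2_Derive c x) (c x) = RtoC 0.

(* The normal line at z of a level set {Re (h z z) = const} (const <> 0) is
   spanned by z, so this is the component of [v] tangent to that level set. *)
Definition quadric_tangent_part (h : C2 -> C2 -> C) (z v : C2) : C2 :=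
  minus v (scal (Re (h v z) / Re (h z z)) z).

(* The Levi-Civita connection of the metric induced on a level set is the
   tangential part of the flat derivative, so this is the acceleration of [c]
   in the level set containing it. *)
Definition covariant_acceleration (h : C2 -> C2 -> C) (c : R -> C2) (x : R) : C2 :=
  quadric_tangent_part h (c x) (C2_Derive (C2_Derive c) x).

Definition geodesic_on (h : C2 -> C2 -> C) (I : R -> Prop) (c : R -> C2) : Prop :=
  forall x : R, I x -> covariant_acceleration h c x = zero.

(* Partial derivative in the first ([false]) or second ([true]) variable. *)
Definition partial (i : bool) (phi : plane -> C2) (p : plane) : C2 :=
  if i then C2_Derive (fun y => phi (fst p, y)) (snd p)
  else C2_Derive (fun y => phi (y, snd p)) (fst p).

Definition smooth_map_on (U : plane -> Prop) (phi : plane -> C2) : Prop :=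
  forall (w : list bool) (p : plane), U p ->
    ex_filterdiff (fold_right partial phi w) (locally p).

Definition immersion_on (U : plane -> Prop) (phi : plane -> C2) : Prop :=
  smooth_map_on U phi /\
  forall p : plane, U p ->
    exists l : plane -> C2,
      filterdiff phi (locally p) l /\ forall v : plane, l v = zero -> v = zero.

Definition sum2 {V : NormedModule R_AbsRing} (F : bool -> V) : V :=
  plus (F false) (F true).

Definition metric_coef (phi : plane -> C2) (p : plane) (i j : bool) : R :=
  Re (herm_E (partial i phi p) (partial j phi p)).

Definition metric_det (phi : plane -> C2) (p : plane) : R :=
  metric_coef phi p false false * metric_coef phi p true true
  - metric_coef phi p false true * metric_coef phi p true false.

(* Entries g^{ij} of the inverse of the 2x2 matrix (g_{ij}). *)
Definition metric_inv (phi : plane -> C2) (p : plane) (i j : bool) : R :=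
  (if Bool.eqb i j then metric_coef phi p (negb i) (negb j)
   else - metric_coef phi p i j) / metric_det phi p.

(* Euclidean orthogonal projection onto the image of the differential:
   sum_{ij} g^{ij} <v, phi_j> phi_i. *)
Definition tangent_part (phi : plane -> C2) (p : plane) (v : C2) : C2 :=
  sum2 (fun i => sum2 (fun j =>
    scal (metric_inv phi p i j * Re (herm_E v (partial j phi p)))
         (partial i phi p))).

(* sigma(d_i, d_j), by the Gauss formula: the normal part of the flat
   derivative of the coordinate field phi_j in the direction phi_i. *)
Definition second_fundamental_form (phi : plane -> C2) (p : plane) (i j : bool) : C2 :=
  minus (partial i (partial j phi) p)
        (tangent_part phi p (partial i (partial j phi) p)).

Definition mean_curvature (phi : plane -> C2) (p : plane) : C2 :=
  scal (1 / 2) (sum2 (fun i => sum2 (fun j =>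
    scal (metric_inv phi p i j) (second_fundamental_form phi p i j)))).

Definition minimal_on (U : plane -> Prop) (phi : plane -> C2) : Prop :=
  forall p : plane, U p -> mean_curvature phi p = zero.

(* phi(t, s) = (alpha_1(t) gamma_1(s), alpha_2(t) gamma_2(s)) *)
Definition product_map (alpha gamma : R -> C2) (p : plane) : C2 :=
  (Cmult (fst (alpha (fst p))) (fst (gamma (snd p))),
   Cmult (snd (alpha (fst p))) (snd (gamma (snd p)))).

Definition rectangle (I J : R -> Prop) (p : plane) : Prop :=
  I (fst p) /\ J (snd p).

(* Main.v *)
Require Import Defs.
From Stdlib Require Import Reals Lra.
From Coquelicot Require Import Coquelicot.
Open Scope R_scope.

(** Write [e = 1] for the sphere and [e = -1] for the anti-de Sitter quadric.
    Both curves then satisfy the same equations: with respect to the Hermitian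
    form [h(z, w) = z1 conj(w1) + e z2 conj(w2)] the position [c] and the
    velocity [c'] are orthogonal, [h(c, c) = e] and [h(c', c') = 1].  So [c] and
    [c'] form an orthogonal basis of C^2, and differentiating these relations
    determines the coordinates of [c''] in it:
      [c'' = - e c + i k c']  with [k = Im h(c'', c')] real
    (lemma [Legendre_frame_equations]).  The component of [c''] tangent to the
    quadric is [i k c'], hence the curve is a geodesic exactly when [k = 0]
    (lemma [geodesic_iff_Legendre_curvature0]).

    For [phi = product_map alpha gamma] the terms [- e c] of the two curves
    cancel, since the signs [e] are opposite:
      [phi_tt + phi_ss = i (kappa phi_t + k phi_s)],
    where [kappa] belongs to [alpha] and [k] to [gamma].  The Legendre conditions
    also make [phi_t] and [phi_s] Hermitian-orthogonal of the same length
    (lemma [product_frame_conformal]).  Thus [phi] is conformal, with some factor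
    [E], and Lagrangian: [i phi_t] and [i phi_s] are normal to the surface.
    In a conformal parametrization [2 E H] is the normal part of
    [phi_tt + phi_ss], which is here the whole vector, so that
      [H = i (kappa phi_t + k phi_s) / (2 E)]
    (lemma [product_mean_curvature]); [E] is not zero because [phi] is an
    immersion.  As [phi_t] and [phi_s] are independent, [H] vanishes at [(t, s)]
    exactly when [kappa(t) = 0] and [k(s) = 0].  Both intervals being nonempty,
    this holds on the whole rectangle exactly when both curves are geodesics. *)

(** * Derivatives of curves in C and C^2 *)

(** The tactic [ring] does not recognize [C] when an equation is typed in one of
    the module structures that [C] carries. *)
Ltac C_ring := match goal with |- ?a = ?b => change (@eq C a b) end; ring.

Lemma is_derive_fst_comp {V W : NormedModule R_AbsRing}
    (f : R -> prod_NormedModule R_AbsRing V W) (x : R)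
    (l : prod_NormedModule R_AbsRing V W) :
  is_derive f x l -> is_derive (fun y => fst (f y) : V) x (fst l).
Proof.
  intros H.
  apply (filterdiff_comp' f (fun z => fst z) x _ (fun z => fst z) H).
  apply filterdiff_linear, is_linear_fst.
Qed.

Lemma is_derive_snd_comp {V W : NormedModule R_AbsRing}
    (f : R -> prod_NormedModule R_AbsRing V W) (x : R)
    (l : prod_NormedModule R_AbsRing V W) :
  is_derive f x l -> is_derive (fun y => snd (f y) : W) x (snd l).
Proof.
  intros H.
  apply (filterdiff_comp' f (fun z => snd z) x _ (fun z => snd z) H).
  apply filterdiff_linear, is_linear_snd.
Qed.

Lemma is_derive_pair {V W : NormedModule R_AbsRing} (f : R -> V) (g : R -> W)
    (x : R) (l : V) (m : W) :
  is_derive f x l -> is_derive g x m ->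
  is_derive (V := prod_NormedModule R_AbsRing V W)
    (fun y => (f y, g y)) x (l, m).
Proof.
  intros Hf Hg.
  apply (filterdiff_comp'_2 (W := prod_NormedModule R_AbsRing V W)
           f g pair x _ _ pair Hf Hg).
  apply (filterdiff_ext_lin _ (fun z => z)); [ | now intros [] ].
  apply (filterdiff_ext (fun z => z)); [ now intros [] | ].
  apply filterdiff_id.
Qed.

Lemma C_ext (a b : C) : Re a = Re b -> Im a = Im b -> a = b.
Proof. destruct a, b; simpl; intros -> ->; reflexivity. Qed.

Lemma is_derive_C (f : R -> C) (x : R) (l : C) :
  is_derive (V := C_R_NormedModule) f x l <->
  is_derive (fun y => Re (f y)) x (Re l) /\ is_derive (fun y => Im (f y)) x (Im l).
Proof.
  split.
  - intros H; split.
    + exact (is_derive_fst_comp (V := R_NormedModule) (W := R_NormedModule) f x l H).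
    + exact (is_derive_snd_comp (V := R_NormedModule) (W := R_NormedModule) f x l H).
  - intros [HRe HIm].
    apply is_derive_ext with (f := fun y => (Re (f y), Im (f y))).
    { intros y; now destruct (f y). }
    destruct l as [lr li].
    exact (is_derive_pair (V := R_NormedModule) (W := R_NormedModule)
             _ _ x lr li HRe HIm).
Qed.

(** [C] is used here as a real vector space, so the product rule is obtained
    from the product rule for the real and imaginary parts. *)
Lemma is_derive_Cmult (f g : R -> C) (x : R) (l m : C) :
  is_derive (V := C_R_NormedModule) f x l ->
  is_derive (V := C_R_NormedModule) g x m ->
  is_derive (V := C_R_NormedModule) (fun y => Cmult (f y) (g y)) x
    (Cplus (Cmult l (g x)) (Cmult (f x) m)).
Proof.
  rewrite !is_derive_C; intros [F1 F2] [G1 G2]; split; simpl.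
  - replace (_ + _) with
      ((Re l * Re (g x) + Re (f x) * Re m) - (Im l * Im (g x) + Im (f x) * Im m))
      by (unfold Re, Im; ring).
    apply (is_derive_minus (V := R_NormedModule)
             (fun y => Re (f y) * Re (g y)) (fun y => Im (f y) * Im (g y)));
      apply @is_derive_mult; auto; apply Rmult_comm.
  - replace (_ + _) with
      ((Re l * Im (g x) + Re (f x) * Im m) + (Im l * Re (g x) + Im (f x) * Re m))
      by (unfold Re, Im; ring).
    apply (is_derive_plus (V := R_NormedModule)
             (fun y => Re (f y) * Im (g y)) (fun y => Im (f y) * Re (g y)));
      apply @is_derive_mult; auto; apply Rmult_comm.
Qed.

Lemma is_derive_Cconj (f : R -> C) (x : R) (l : C) :
  is_derive (V := C_R_NormedModule) f x l ->
  is_derive (V := C_R_NormedModule) (fun y => Cconj (f y)) x (Cconj l).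
Proof.
  rewrite !is_derive_C; intros [F1 F2]; split; [ exact F1 | ].
  apply (is_derive_opp (V := R_NormedModule) (fun y => Im (f y))), F2.
Qed.

Lemma is_derive_C_locally_const (f : R -> C) (x : R) (a l : C) :
  locally x (fun y => f y = a) -> is_derive (V := C_R_NormedModule) f x l ->
  l = RtoC 0.
Proof.
  intros Ha Hf.
  apply (is_derive_ext_loc (K := R_AbsRing) (V := C_R_NormedModule) _ (fun _ => a) _ _ Ha),
    is_derive_C in Hf.
  destruct Hf as [H1 H2]; apply is_derive_unique in H1, H2.
  rewrite Derive_const in H1, H2.
  destruct l; unfold RtoC; simpl in *; now subst.
Qed.

(** [C2_Derive] is built from [Derive] on the four real coordinates; this links
    it to the derivative in the normed module [C2], from which all rules are
    taken. *)
Lemma C2_Derive_unique (c : R -> C2) (x : R) (l : C2) :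
  is_derive c x l -> C2_Derive c x = l.
Proof.
  intros H; destruct l as [[l1 l2] [l3 l4]].
  pose proof (proj1 (is_derive_C _ _ _) (is_derive_fst_comp c x _ H)) as [H1 H2].
  pose proof (proj1 (is_derive_C _ _ _) (is_derive_snd_comp c x _ H)) as [H3 H4].
  apply is_derive_unique in H1, H2, H3, H4.
  simpl in *; unfold C2_Derive, C_Derive; repeat f_equal; assumption.
Qed.

Lemma C2_Derive_correct (c : R -> C2) (x : R) :
  ex_derive c x -> is_derive c x (C2_Derive c x).
Proof.
  intros [l H]; now rewrite (C2_Derive_unique c x l H).
Qed.

Lemma C2_Derive_ext_loc (c d : R -> C2) (x : R) :
  locally x (fun y => c y = d y) -> C2_Derive c x = C2_Derive d x.
Proof.
  intros H; unfold C2_Derive, C_Derive.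
  f_equal; f_equal; apply Derive_ext_loc;
    revert H; apply filter_imp; intros y ->; reflexivity.
Qed.

(** * Diagonal Hermitian forms on C^2 *)

(** One family of forms containing [herm_E] ([e = 1]) and [herm_L] ([e = -1]),
    so that the two kinds of Legendre curves are treated together. *)
Definition herm (e : R) (z w : C2) : C :=
  Cplus (Cmult (fst z) (Cconj (fst w)))
        (Cmult (RtoC e) (Cmult (snd z) (Cconj (snd w)))).

Definition cscal (c : C) (z : C2) : C2 := (Cmult c (fst z), Cmult c (snd z)).

Definition cmul2 (z w : C2) : C2 := (Cmult (fst z) (fst w), Cmult (snd z) (snd w)).

Lemma Cconj_RtoC (r : R) : Cconj (RtoC r) = RtoC r.
Proof. unfold Cconj, RtoC; simpl; now rewrite Ropp_0. Qed.

Lemma RtoC_m1 : RtoC (-1) = Copp (RtoC 1).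
Proof. exact (RtoC_opp 1). Qed.

Lemma herm_E_eq z w : herm_E z w = herm 1 z w.
Proof. unfold herm_E, herm; ring. Qed.

Lemma herm_L_eq z w : herm_L z w = herm (-1) z w.
Proof. unfold herm_L, herm; rewrite RtoC_m1; ring. Qed.

Lemma S3_herm (z : C2) : S3 z -> herm 1 z z = RtoC 1.
Proof.
  unfold S3, herm; intros H; rewrite <- !Cmod2_conj.
  rewrite <- RtoC_mult, <- RtoC_plus; f_equal; lra.
Qed.

Lemma H31_herm (z : C2) : H31 z -> herm (-1) z z = RtoC (-1).
Proof.
  unfold H31, herm; intros H; rewrite <- !Cmod2_conj.
  rewrite <- RtoC_mult, <- RtoC_plus; f_equal; lra.
Qed.

Lemma herm_conj (e : R) (z w : C2) : Cconj (herm e z w) = herm e w z.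
Proof.
  unfold herm; rewrite Cplus_conj, !Cmult_conj, !Cconj_conj, Cconj_RtoC; ring.
Qed.

Lemma herm_sym_eq0 (e : R) (z w : C2) : herm e z w = RtoC 0 -> herm e w z = RtoC 0.
Proof. intros H; rewrite <- herm_conj, H; apply Cconj_RtoC. Qed.

Lemma Im_herm_diag (e : R) (z : C2) : Im (herm e z z) = 0.
Proof.
  pose proof (f_equal Im (herm_conj e z z)) as H.
  rewrite im_conj in H; lra.
Qed.

Lemma herm_plus_l (e : R) (z z' w : C2) :
  herm e (plus z z') w = Cplus (herm e z w) (herm e z' w).
Proof.
  unfold herm; change (plus z z') with (Cplus (fst z) (fst z'), Cplus (snd z) (snd z'));
  simpl; C_ring.
Qed.

Lemma herm_cscal_l (e : R) (c : C) (z w : C2) :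
  herm e (cscal c z) w = Cmult c (herm e z w).
Proof. unfold herm; simpl; ring. Qed.

Lemma cscal_0 (z : C2) : cscal (RtoC 0) z = zero.
Proof.
  unfold cscal; rewrite !Cmult_0_l; reflexivity.
Qed.

Lemma herm_zero_l (e : R) (w : C2) : herm e zero w = RtoC 0.
Proof. rewrite <- (cscal_0 zero), herm_cscal_l; ring. Qed.

Lemma scal_cscal (r : R) (z : C2) : scal r z = cscal (RtoC r) z.
Proof.
  destruct z as [[a b] [c d]].
  repeat (unfold cscal, Cmult, scal, mult, prod_scal; simpl).
  apply injective_projections; apply injective_projections; simpl; ring.
Qed.

Lemma scal_eq_0_C2 (r : R) (z : C2) : r <> 0 -> scal r z = zero -> z = zero.
Proof.
  intros Hr Hz.
  transitivity (scal (mult (/ r) r) z).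
  { change (mult (/ r) r) with (/ r * r); rewrite Rinv_l by exact Hr.
    symmetry; apply (scal_one (V := C2)). }
  refine (eq_trans (eq_sym (scal_assoc (V := C2) (/ r) r z)) _).
  refine (eq_trans (f_equal (scal (/ r)) Hz) _).
  apply (scal_zero_r (V := C2)).
Qed.

Lemma Ci_mult_real_eq0 (k : R) : Cmult Ci (RtoC k) = RtoC 0 -> k = 0.
Proof. intros H; apply (f_equal Im) in H; simpl in H; lra. Qed.

Lemma is_derive_herm (e : R) (c d : R -> C2) (x : R) (l m : C2) :
  is_derive c x l -> is_derive d x m ->
  is_derive (V := C_R_NormedModule) (fun y => herm e (c y) (d y)) x
    (Cplus (herm e l (d x)) (herm e (c x) m)).
Proof.
  intros Hc Hd.
  pose proof (is_derive_fst_comp c x l Hc) as Hc1.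
  pose proof (is_derive_snd_comp c x l Hc) as Hc2.
  pose proof (is_derive_Cconj _ x _ (is_derive_fst_comp d x m Hd)) as Hd1.
  pose proof (is_derive_Cconj _ x _ (is_derive_snd_comp d x m Hd)) as Hd2.
  pose proof (is_derive_Cmult _ _ x _ _ Hc1 Hd1) as P1.
  pose proof (is_derive_Cmult _ _ x _ _ Hc2 Hd2) as P2.
  pose proof (is_derive_Cmult _ _ x _ _
    (is_derive_const (V := C_R_NormedModule) (RtoC e) x) P2) as P3.
  pose proof (is_derive_plus (V := C_R_NormedModule) _ _ x _ _ P1 P3) as P4.
  unfold herm.
  match goal with |- is_derive _ _ ?r =>
    match type of P4 with is_derive _ _ ?q => replace r with q; [ exact P4 | ] end end.
  change (@plus C_R_NormedModule) with Cplus.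
  change (@zero C_R_NormedModule) with (RtoC 0).
  C_ring.
Qed.

Lemma is_derive_cmul2 (a : C2) (c : R -> C2) (x : R) (l : C2) :
  is_derive c x l -> is_derive (V:=C2) (fun y => cmul2 a (c y)) x (cmul2 a l).
Proof.
  intros Hc.
  pose proof (is_derive_Cmult _ _ x _ _
    (is_derive_const (V := C_R_NormedModule) (fst a) x) (is_derive_fst_comp c x l Hc)) as P1.
  pose proof (is_derive_Cmult _ _ x _ _
    (is_derive_const (V := C_R_NormedModule) (snd a) x) (is_derive_snd_comp c x l Hc)) as P2.
  pose proof (is_derive_pair _ _ x _ _ P1 P2) as P.
  unfold cmul2.
  match goal with |- is_derive _ _ ?r =>
    match type of P with is_derive _ _ ?q => replace r with q; [ exact P | ] end end.
  change (@zero C_R_NormedModule) with (RtoC 0).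
  f_equal; C_ring.
Qed.

(** * The Frenet equation of a Legendre curve *)

(** Since [e] times the squared modulus of the determinant of [(g, g1)] equals
    the Gram determinant [h(g, g) h(g1, g1) - h(g1, g) h(g, g1) = e], the vectors
    [g] and [g1] form a basis of C^2; the form being nondegenerate, only [0] is
    orthogonal to both. *)
Lemma Legendre_frame_complete (e : R) (g g1 v : C2) :
  e * e = 1 -> herm e g g = RtoC e -> herm e g1 g1 = RtoC 1 ->
  herm e g1 g = RtoC 0 -> herm e v g = RtoC 0 -> herm e v g1 = RtoC 0 ->
  v = zero.
Proof.
  intros He Hgg H11 H1g Hv Hv1.
  assert (He' : Cmult (RtoC e) (RtoC e) = RtoC 1) by (now rewrite <- RtoC_mult, He).
  assert (Hg1 : herm e g g1 = RtoC 0).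
  { transitivity (Cconj (herm e g1 g)).
    - unfold herm. rewrite Cplus_conj, !Cmult_conj, !Cconj_conj.
      replace (Cconj (RtoC e)) with (RtoC e); [ ring | ].
      unfold Cconj, RtoC; simpl. now rewrite Ropp_0.
    - rewrite H1g. unfold Cconj, RtoC; simpl. now rewrite Ropp_0. }
  destruct g as [p q], g1 as [p1 q1], v as [v w].
  unfold herm in *; simpl in *.
  set (E := RtoC e) in *; clearbody E.
  set (p' := Cconj p) in *. set (q' := Cconj q) in *.
  set (p1' := Cconj p1) in *. set (q1' := Cconj q1) in *.
  clearbody p' q' p1' q1'.
  set (D := (p * q1 - q * p1)%C). set (D' := (p' * q1' - q' * p1')%C).
  (* Lagrange's identity: the Gram determinant of [g], [g1] is [E D D']. *)
  assert (Hdet : Cmult E (Cmult D D') = E).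
  { transitivity ((p * p' + E * (q * q')) * (p1 * p1' + E * (q1 * q1'))
       - (p1 * p' + E * (q1 * q')) * (p * p1' + E * (q * q1')))%C;
      [ unfold D, D'; ring | rewrite Hgg, H11, H1g; ring ]. }
  assert (Hdet' : Cmult D D' = RtoC 1).
  { transitivity (E * E * (D * D'))%C; [ rewrite He'; ring | ].
    rewrite <- Cmult_assoc, Hdet; exact He'. }
  assert (v = RtoC 0) as ->.
  { transitivity (v * (D * D'))%C; [ rewrite Hdet'; ring | ].
    transitivity (D * (q1' * (v * p' + E * (w * q')) - q' * (v * p1' + E * (w * q1'))))%C;
      [ unfold D'; ring | rewrite Hv, Hv1; ring ]. }
  assert (w = RtoC 0) as ->; [ | reflexivity ].
  { transitivity (E * E * w * (D * D'))%C; [ rewrite Hdet', He'; ring | ].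
    transitivity (E * D * (p' * (RtoC 0 * p1' + E * (w * q1')) - p1' * (RtoC 0 * p' + E * (w * q'))))%C;
      [ unfold D'; ring | rewrite Hv, Hv1; ring ]. }
Qed.

(** For [g = (p, q)], a vector orthogonal to [g] is a multiple of
    [(- e conj(q), conj(p))], and the normalization of [g1] makes the factor
    unimodular. *)
Lemma Legendre_moduli (e : R) (g g1 : C2) :
  e * e = 1 -> herm e g g = RtoC e -> herm e g1 g1 = RtoC 1 ->
  herm e g1 g = RtoC 0 ->
  Cmult (fst g1) (Cconj (fst g1)) = Cmult (snd g) (Cconj (snd g)) /\
  Cmult (snd g1) (Cconj (snd g1)) = Cmult (fst g) (Cconj (fst g)).
Proof.
  intros He Hgg H11 H1g.
  pose proof (herm_sym_eq0 _ _ _ H1g) as Hg1.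
  assert (He' : Cmult (RtoC e) (RtoC e) = RtoC 1) by (now rewrite <- RtoC_mult, He).
  unfold herm in *.
  destruct g as [p q], g1 as [p1 q1]; simpl in *.
  set (p' := Cconj p) in *. set (q' := Cconj q) in *.
  set (p1' := Cconj p1) in *. set (q1' := Cconj q1) in *.
  set (E := RtoC e) in *.
  clearbody p' q' p1' q1' E.
  (* Squared moduli of the two terms of [h(g1, g) = 0]. *)
  assert (A : (p1 * p1' * (p * p') = q1 * q1' * (q * q'))%C).
  { transitivity ((p1 * p' + E * (q1 * q')) * (p * p1')
      - E * (q1 * q') * (p * p1' + E * (q * q1')) + E * E * (q1 * q1' * (q * q')))%C;
      [ ring | rewrite H1g, Hg1, He'; ring ]. }
  assert (B : (p1 * p1' = q * q')%C).
  { transitivity (E * E * (p1 * p1'))%C; [ rewrite He'; ring | ].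
    rewrite <- Hgg at 2.
    transitivity (E * (p1 * p1' * (p * p')) + E * E * (p1 * p1' * (q * q')))%C; [ ring | ].
    rewrite A, He'.
    transitivity ((p1 * p1' + E * (q1 * q1')) * (q * q'))%C; [ ring | ].
    rewrite H11; ring. }
  split; [ exact B | ].
  transitivity (E * E * (q1 * q1'))%C; [ rewrite He'; ring | ].
  transitivity (E * (p1 * p1' + E * (q1 * q1')) - E * (p1 * p1'))%C; [ ring | ].
  rewrite H11, B.
  transitivity (E - E * (q * q'))%C; [ ring | ].
  rewrite <- Hgg at 1; ring.
Qed.

(** The real number [k] in [c'' = - e c + i k c']; up to sign it is the curvature
    of [c] in its quadric. *)
Definition Legendre_curvature (e : R) (c : R -> C2) (x : R) : R :=
  Im (herm e (C2_Derive (C2_Derive c) x) (C2_Derive c x)).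

(** Differentiating [h(c', c) = 0] gives [h(c'', c) = -1], and differentiating
    [h(c', c') = 1] shows that [h(c'', c')] is imaginary.  Therefore
    [c'' + e c - i k c'] is orthogonal to [c] and to [c'], hence zero. *)
Lemma Legendre_frame_equations (e : R) (h : C2 -> C2 -> C) (M : C2 -> Prop)
    (I : R -> Prop) (c : R -> C2) :
  e * e = 1 -> (forall z w, h z w = herm e z w) ->
  (forall z, M z -> herm e z z = RtoC e) -> open I ->
  unit_speed_Legendre h M I c ->
  forall x, I x ->
  herm e (c x) (c x) = RtoC e /\
  herm e (C2_Derive c x) (C2_Derive c x) = RtoC 1 /\
  herm e (C2_Derive c x) (c x) = RtoC 0 /\
  C2_Derive (C2_Derive c) x =
    plus (cscal (RtoC (- e)) (c x))
         (cscal (Cmult Ci (RtoC (Legendre_curvature e c x))) (C2_Derive c x)).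
Proof.
  intros He Hh HM Hopen [Hs HL] x Hx.
  assert (Hgg : forall y, I y -> herm e (c y) (c y) = RtoC e).
  { intros y Hy; apply HM, HL, Hy. }
  assert (H11 : forall y, I y -> herm e (C2_Derive c y) (C2_Derive c y) = RtoC 1).
  { intros y Hy; apply C_ext; [ | apply Im_herm_diag ].
    rewrite <- Hh; apply HL, Hy. }
  assert (H1g : forall y, I y -> herm e (C2_Derive c y) (c y) = RtoC 0).
  { intros y Hy; rewrite <- Hh; apply HL, Hy. }
  assert (Hloc : forall P : R -> Prop, (forall y, I y -> P y) -> locally x P).
  { intros P HP; exact (locally_open I P Hopen HP x Hx). }
  pose proof (C2_Derive_correct c x (Hs 0%nat x Hx)) as D1.
  pose proof (C2_Derive_correct (C2_Derive c) x (Hs 1%nat x Hx)) as D2.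
  pose proof (is_derive_C_locally_const _ _ _ _ (Hloc _ H1g)
                (is_derive_herm e _ _ x _ _ D2 D1)) as K1.
  pose proof (is_derive_C_locally_const _ _ _ _ (Hloc _ H11)
                (is_derive_herm e _ _ x _ _ D2 D2)) as K2.
  specialize (Hgg x Hx); specialize (H11 x Hx); specialize (H1g x Hx).
  rewrite H11 in K1.
  repeat split; auto.
  unfold Legendre_curvature.
  set (a := C2_Derive (C2_Derive c) x) in *. set (v := C2_Derive c x) in *.
  set (k := Im (herm e a v)).
  assert (Kav : herm e a v = Cmult Ci (RtoC k)).
  { rewrite <- (herm_conj e a v) in K2.
    apply (f_equal Re) in K2.
    change (Re (herm e a v) + Re (Cconj (herm e a v)) = 0) in K2.
    rewrite re_conj in K2. apply C_ext.
    - transitivity 0; [ lra | simpl; ring ].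
    - change (k = 0 * 0 + 1 * k); ring. }
  assert (Z : plus a (plus (cscal (RtoC e) (c x)) (cscal (Copp (Cmult Ci (RtoC k))) v)) = zero).
  { assert (He' : Cmult (RtoC e) (RtoC e) = RtoC 1) by (now rewrite <- RtoC_mult, He).
    apply (Legendre_frame_complete e (c x) v); auto; rewrite !herm_plus_l, !herm_cscal_l.
    - rewrite Hgg, H1g, He'.
      transitivity (Cplus (herm e a (c x)) (RtoC 1)); [ ring | exact K1 ].
    - rewrite H11, Kav, (herm_sym_eq0 _ _ _ H1g); ring. }
  assert (isolate : forall b E g w K : C,
    (b + (E * g + - K * w) = RtoC 0 -> b = - E * g + K * w)%C).
  { intros b E z w K H; transitivity (b + (E * z + - K * w) + (- E * z + K * w))%C;
      [ ring | rewrite H; ring ]. }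
  rewrite RtoC_opp; apply injective_projections; apply isolate.
  - exact (f_equal fst Z).
  - exact (f_equal snd Z).
Qed.

(** The tangential projection removes from [c'' = - e c + i k c'] exactly the
    term along [c], so the covariant acceleration is [i k c'] and [c'] is not
    zero. *)
Lemma geodesic_iff_Legendre_curvature0 (e : R) (h : C2 -> C2 -> C) (M : C2 -> Prop)
    (I : R -> Prop) (c : R -> C2) :
  e * e = 1 -> (forall z w, h z w = herm e z w) ->
  (forall z, M z -> herm e z z = RtoC e) -> open I ->
  unit_speed_Legendre h M I c ->
  (geodesic_on h I c <-> forall x, I x -> Legendre_curvature e c x = 0).
Proof.
  intros He Hh HM Hopen Hc.
  assert (Hacc : forall x, I x -> covariant_acceleration h c x =
    cscal (Cmult Ci (RtoC (Legendre_curvature e c x))) (C2_Derive c x)).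
  { intros x Hx.
    destruct (Legendre_frame_equations e h M I c He Hh HM Hopen Hc x Hx)
      as (Hgg & H11 & H1g & Hs).
    unfold covariant_acceleration, quadric_tangent_part; rewrite !Hh.
    set (k := Legendre_curvature e c x) in *; clearbody k.
    rewrite Hs, herm_plus_l, !herm_cscal_l, Hgg, H1g.
    replace (_ / _) with (- e).
    2:{ replace (Re (RtoC e)) with e by reflexivity.
        assert (e <> 0) by (intros ->; lra).
        simpl. field_simplify; auto. }
    rewrite scal_cscal; unfold minus.
    rewrite (plus_comm (cscal _ (c x))), <- plus_assoc.
    rewrite (plus_opp_r (cscal _ (c x))).
    apply plus_zero_r. }
  split; intros H x Hx.
  - destruct (Legendre_frame_equations e h M I c He Hh HM Hopen Hc x Hx)
      as (_ & H11 & _ & _).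
    specialize (H x Hx); rewrite Hacc in H by exact Hx.
    apply Ci_mult_real_eq0.
    transitivity (herm e (cscal (Cmult Ci (RtoC (Legendre_curvature e c x))) (C2_Derive c x))
                    (C2_Derive c x)).
    + rewrite herm_cscal_l, H11; ring.
    + rewrite H; apply herm_zero_l.
  - rewrite Hacc, H, Cmult_0_r by exact Hx; apply cscal_0.
Qed.

(** * Mean curvature in conformal coordinates *)

(** In conformal coordinates the trace of the second fundamental form is the
    normal part of the flat Laplacian [L] divided by [E]: the mixed derivatives
    do not enter, as the inverse metric is diagonal.  The last hypothesis says
    that [L] is already normal. *)
Lemma conformal_mean_curvature (phi : plane -> C2) (p : plane) (E : R)
    (L := plus (partial false (partial false phi) p) (partial true (partial true phi) p)) :
  E <> 0 ->
  metric_coef phi p false false = E -> metric_coef phi p true true = E ->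
  metric_coef phi p false true = 0 -> metric_coef phi p true false = 0 ->
  (forall i, Re (herm_E L (partial i phi p)) = 0) ->
  mean_curvature phi p = scal (1 / (2 * E)) L.
Proof.
  intros HE H00 H11 H01 H10 HL.
  pose proof (HL false) as HF; pose proof (HL true) as HT; clear HL.
  unfold mean_curvature, second_fundamental_form, tangent_part, metric_inv, metric_det, sum2;
    cbn [negb Bool.eqb].
  rewrite H00, H11, H01, H10.
  subst L.
  set (T := partial false phi p) in *. set (P := partial true phi p) in *.
  set (X := partial false (partial false phi) p) in *.
  set (Y := partial true (partial true phi) p) in *.
  set (Z := partial false (partial true phi) p) in *.
  set (W := partial true (partial false phi) p) in *.
  assert (Hadd : forall V, Re (herm_E (plus X Y) V) = Re (herm_E X V) + Re (herm_E Y V)).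
  { intros V; unfold herm_E; simpl; unfold plus; simpl; ring. }
  rewrite Hadd in HF, HT.
  set (xT := Re (herm_E X T)) in *. set (yT := Re (herm_E Y T)) in *.
  set (xP := Re (herm_E X P)) in *. set (yP := Re (herm_E Y P)) in *.
  assert (yT = - xT) as -> by lra. assert (yP = - xP) as -> by lra.
  set (zT := Re (herm_E Z T)) in *. set (zP := Re (herm_E Z P)) in *.
  set (wT := Re (herm_E W T)) in *. set (wP := Re (herm_E W P)) in *.
  clearbody xT xP zT zP wT wP.
  clearbody T P X Y Z W.
  destruct T as [[? ?] [? ?]], P as [[? ?] [? ?]], X as [[? ?] [? ?]],
    Y as [[? ?] [? ?]], Z as [[? ?] [? ?]], W as [[? ?] [? ?]].
  repeat (unfold minus, plus, scal, opp, mult, prod_plus, prod_scal, prod_opp; simpl).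
  apply injective_projections; apply injective_projections; simpl.
  all: field; exact HE.
Qed.

(** * The product map *)

(** Here [cmul2 a1 g] and [cmul2 a g1] stand for [phi_t] and [phi_s].  They are
    orthogonal over C, not only over R: this contains at once the orthogonality
    of the coordinate lines and the Lagrangian condition. *)
Lemma product_frame_conformal (g g1 a a1 : C2)
    (E := Cmod (fst g) ^ 2 + Cmod (fst a) ^ 2) :
  herm 1 g g = RtoC 1 -> herm 1 g1 g1 = RtoC 1 -> herm 1 g1 g = RtoC 0 ->
  herm (-1) a a = RtoC (-1) -> herm (-1) a1 a1 = RtoC 1 -> herm (-1) a1 a = RtoC 0 ->
  herm 1 (cmul2 a1 g) (cmul2 a g1) = RtoC 0 /\
  herm 1 (cmul2 a1 g) (cmul2 a1 g) = RtoC E /\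
  herm 1 (cmul2 a g1) (cmul2 a g1) = RtoC E.
Proof.
  intros Hgg Hg11 Hg1g Haa Ha11 Ha1a.
  destruct (Legendre_moduli 1 g g1 ltac:(ring) Hgg Hg11 Hg1g) as [G1 G2].
  destruct (Legendre_moduli (-1) a a1 ltac:(ring) Haa Ha11 Ha1a) as [A1 A2].
  apply herm_sym_eq0 in Hg1g.
  assert (HE : RtoC E = (fst g * Cconj (fst g) + fst a * Cconj (fst a))%C)
    by (unfold E; rewrite RtoC_plus, !Cmod2_conj; reflexivity).
  rewrite HE; clear E HE.
  unfold herm, cmul2 in *; simpl fst in *; simpl snd in *; rewrite !Cmult_conj.
  destruct g as [p q], g1 as [p1 q1], a as [x y], a1 as [x1 y1]; simpl in *.
  set (p' := Cconj p) in *. set (q' := Cconj q) in *.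
  set (p1' := Cconj p1) in *. set (q1' := Cconj q1) in *.
  set (x' := Cconj x) in *. set (y' := Cconj y) in *.
  set (x1' := Cconj x1) in *. set (y1' := Cconj y1) in *.
  clearbody p' q' p1' q1' x' y' x1' y1'.
  rewrite RtoC_m1 in *.
  repeat split.
  - transitivity ((x1 * x' + - (1) * (y1 * y')) * (p * p1')
      + (y1 * y') * (p * p1' + 1 * (q * q1')))%C; [ ring | rewrite Ha1a, Hg1g; ring ].
  - transitivity ((x1 * x1') * (p * p') + (y1 * y1') * (q * q'))%C; [ ring | ].
    rewrite A1, A2.
    transitivity ((p * p' + 1 * (q * q')) * (x * x') - (x * x' + - (1) * (y * y')) * (p * p'))%C;
      [ ring | rewrite Hgg, Haa; ring ].
  - transitivity ((p1 * p1') * (x * x') + (q1 * q1') * (y * y'))%C; [ ring | ].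
    rewrite G1, G2.
    transitivity ((p * p' + 1 * (q * q')) * (x * x') - (x * x' + - (1) * (y * y')) * (p * p'))%C;
      [ ring | rewrite Hgg, Haa; ring ].
Qed.

Lemma partial_t_product (a g : R -> C2) (p : plane) :
  ex_derive a (fst p) ->
  partial false (product_map a g) p = product_map (C2_Derive a) g p.
Proof.
  intros Ha; destruct p as [t s]; apply C2_Derive_unique; simpl in *.
  pose proof (is_derive_cmul2 (g s) a t _ (C2_Derive_correct a t Ha)) as H.
  assert (comm : forall z w, cmul2 z w = cmul2 w z)
    by (intros; unfold cmul2; f_equal; ring).
  rewrite comm in H; revert H; apply is_derive_ext.
  intros y; apply comm.
Qed.

Lemma partial_s_product (a g : R -> C2) (p : plane) :
  ex_derive g (snd p) ->
  partial true (product_map a g) p = product_map a (C2_Derive g) p.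
Proof.
  intros Hg; destruct p as [t s]; apply C2_Derive_unique; simpl in *.
  exact (is_derive_cmul2 (a t) g s _ (C2_Derive_correct g s Hg)).
Qed.

(** The first partial derivative has product form only where [a] is
    differentiable, hence the passage through a neighbourhood in the open set
    [I]. *)
Lemma partial_tt_product (I : R -> Prop) (a g : R -> C2) (p : plane) :
  open I -> smooth_curve_on I a -> I (fst p) ->
  partial false (partial false (product_map a g)) p =
  product_map (C2_Derive (C2_Derive a)) g p.
Proof.
  intros HI Ha Hp.
  rewrite <- partial_t_product by exact (Ha 1%nat _ Hp).
  unfold partial at 1 3; apply C2_Derive_ext_loc.
  apply (locally_open I); auto.
  intros y Hy; apply partial_t_product, (Ha 0%nat), Hy.
Qed.

Lemma partial_ss_product (I : R -> Prop) (a g : R -> C2) (p : plane) :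
  open I -> smooth_curve_on I g -> I (snd p) ->
  partial true (partial true (product_map a g)) p =
  product_map a (C2_Derive (C2_Derive g)) p.
Proof.
  intros HI Hg Hp.
  rewrite <- partial_s_product by exact (Hg 1%nat _ Hp).
  unfold partial at 1 3; apply C2_Derive_ext_loc.
  apply (locally_open I); auto.
  intros y Hy; apply partial_s_product, (Hg 0%nat), Hy.
Qed.

(** The partial derivative in [s] is the value of the injective differential at
    the second basis vector. *)
Lemma immersion_partial_neq0 (U : plane -> Prop) (phi : plane -> C2) (p : plane) :
  immersion_on U phi -> U p -> partial true phi p <> zero.
Proof.
  intros [_ H] Hp; destruct (H p Hp) as [l [Hl Hinj]]; clear H; intros H0.
  destruct p as [t s].
  assert (D : is_derive (V := C2) (fun y => phi (t, y)) s (l (0, 1))).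
  { pose proof (is_derive_pair (V := R_NormedModule) (W := R_NormedModule)
      (fun _ => t) (fun y => y) s _ _ (is_derive_const _ s) (is_derive_id s)) as Hy.
    pose proof (filterdiff_comp' _ phi s _ l Hy Hl) as Hc.
    apply (filterdiff_ext_lin _ _ _ Hc).
    intros y; destruct Hl as [Hlin _].
    rewrite (linear_scal l Hlin); reflexivity. }
  apply C2_Derive_unique in D; apply (eq_trans (eq_sym D)) in H0.
  apply Hinj, (f_equal snd) in H0; exact (R1_neq_R0 H0).
Qed.

(** The radial terms [alpha gamma] and [- alpha gamma] of [phi_tt] and [phi_ss]
    cancel, and what remains is already normal because [phi_t] and [phi_s] are
    Hermitian-orthogonal: no projection is left in the formula. *)
Lemma product_mean_curvature (I J : R -> Prop) (gamma alpha : R -> C2) (p : plane)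
    (phi := product_map alpha gamma)
    (E := Cmod (fst (gamma (snd p))) ^ 2 + Cmod (fst (alpha (fst p))) ^ 2)
    (k := Legendre_curvature 1 gamma (snd p))
    (kappa := Legendre_curvature (-1) alpha (fst p)) :
  open I -> open J ->
  unit_speed_Legendre herm_E S3 J gamma ->
  unit_speed_Legendre herm_L H31 I alpha ->
  immersion_on (rectangle I J) phi -> rectangle I J p ->
  E <> 0 /\
  herm 1 (partial true phi p) (partial true phi p) = RtoC E /\
  herm 1 (partial false phi p) (partial false phi p) = RtoC E /\
  herm 1 (partial false phi p) (partial true phi p) = RtoC 0 /\
  mean_curvature phi p =
    scal (1 / (2 * E))
      (plus (cscal (Cmult Ci (RtoC kappa)) (partial false phi p))
            (cscal (Cmult Ci (RtoC k)) (partial true phi p))).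
Proof.
  intros HI HJ Hg Ha Himm [Ht Hs].
  destruct (Legendre_frame_equations 1 _ _ _ _ ltac:(ring) herm_E_eq S3_herm HJ Hg _ Hs)
    as (Hgg & Hg11 & Hg1g & Hg2).
  destruct (Legendre_frame_equations (-1) _ _ _ _ ltac:(ring) herm_L_eq H31_herm HI Ha _ Ht)
    as (Haa & Ha11 & Ha1a & Ha2).
  fold k in Hg2; fold kappa in Ha2.
  destruct (product_frame_conformal _ _ _ _ Hgg Hg11 Hg1g Haa Ha11 Ha1a) as (HTP & HTT & HPP).
  fold E in HTT, HPP.
  pose proof (immersion_partial_neq0 _ _ p Himm (conj Ht Hs)) as HP0.
  destruct Hg as [Hgs _], Ha as [Has _].
  pose proof (partial_t_product alpha gamma p (Has 0%nat _ Ht)) as DT.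
  pose proof (partial_s_product alpha gamma p (Hgs 0%nat _ Hs)) as DP.
  pose proof (partial_tt_product I alpha gamma p HI Has Ht) as DTT.
  pose proof (partial_ss_product J alpha gamma p HJ Hgs Hs) as DPP.
  fold phi in DT, DP, DTT, DPP.
  change (cmul2 (C2_Derive alpha (fst p)) (gamma (snd p)))
    with (product_map (C2_Derive alpha) gamma p) in HTP, HTT.
  change (cmul2 (alpha (fst p)) (C2_Derive gamma (snd p)))
    with (product_map alpha (C2_Derive gamma) p) in HTP, HPP.
  (* [phi_tt + phi_ss], after cancellation of the radial terms. *)
  assert (HL : plus (partial false (partial false phi) p) (partial true (partial true phi) p)
    = plus (cscal (Cmult Ci (RtoC kappa)) (partial false phi p))
           (cscal (Cmult Ci (RtoC k)) (partial true phi p))).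
  { rewrite DTT, DPP, DT, DP; unfold product_map; rewrite Ha2, Hg2, !RtoC_opp, RtoC_m1.
    clearbody k kappa.
    apply injective_projections;
      change (@plus C2) with (fun z w : C2 => (Cplus (fst z) (fst w), Cplus (snd z) (snd w)));
      cbn [fst snd cscal]; C_ring. }
  rewrite <- DT, <- DP in *.
  pose proof (herm_sym_eq0 _ _ _ HTP) as HPT.
  (* [E] is the squared length of [phi_s]. *)
  assert (HE : E <> 0).
  { intros HE; apply HP0; rewrite HE in HPP; unfold herm in HPP.
    rewrite <- !Cmod2_conj, <- RtoC_mult, <- RtoC_plus in HPP.
    apply RtoC_inj in HPP.
    pose proof (pow2_ge_0 (Cmod (fst (partial true phi p)))).
    pose proof (pow2_ge_0 (Cmod (snd (partial true phi p)))).
    apply injective_projections; apply Cmod_eq_0; apply Rsqr_0_uniq; unfold Rsqr; lra. }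
  repeat split; auto.
  rewrite <- HL; apply conformal_mean_curvature; auto; unfold metric_coef;
    rewrite ?herm_E_eq, ?HTT, ?HPP, ?HTP, ?HPT; auto.
  intros i; rewrite HL, herm_E_eq, herm_plus_l, !herm_cscal_l.
  destruct i; rewrite ?HTT, ?HPP, ?HTP, ?HPT; simpl; ring.
Qed.

(** * Minimality *)

Lemma open_Rbar_interval (a b : Rbar) : open (Rbar_open_interval a b).
Proof. apply open_and; [ apply open_Rbar_gt | apply open_Rbar_lt ]. Qed.

Lemma Rbar_open_interval_nonempty (a b : Rbar) :
  Rbar_lt a b -> exists x, Rbar_open_interval a b x.
Proof.
  intros H; destruct a as [a | | ], b as [b | | ]; simpl in H; try contradiction.
  - exists ((a + b) / 2); split; simpl; lra.
  - exists (a + 1); split; simpl; auto; lra.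
  - exists (b - 1); split; simpl; auto; lra.
  - exists 0; split; simpl; auto.
Qed.

Theorem theorem4p1 (a1 b1 a2 b2 : Rbar) (gamma alpha : R -> C2)
    (hI1 : Rbar_lt a1 b1) (hI2 : Rbar_lt a2 b2)
    (hgamma : unit_speed_Legendre herm_E S3 (Rbar_open_interval a1 b1) gamma)
    (halpha : unit_speed_Legendre herm_L H31 (Rbar_open_interval a2 b2) alpha)
    (himm : immersion_on (rectangle (Rbar_open_interval a2 b2) (Rbar_open_interval a1 b1))
              (product_map alpha gamma)) :
  minimal_on (rectangle (Rbar_open_interval a2 b2) (Rbar_open_interval a1 b1))
    (product_map alpha gamma) <->
  geodesic_on herm_E (Rbar_open_interval a1 b1) gamma /\
  geodesic_on herm_L (Rbar_open_interval a2 b2) alpha.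
Proof.
  pose proof (open_Rbar_interval a1 b1) as HJ.
  pose proof (open_Rbar_interval a2 b2) as HI.
  rewrite (geodesic_iff_Legendre_curvature0 1 _ _ _ _ ltac:(ring)
             herm_E_eq S3_herm HJ hgamma).
  rewrite (geodesic_iff_Legendre_curvature0 (-1) _ _ _ _ ltac:(ring)
             herm_L_eq H31_herm HI halpha).
  pose proof (fun p => product_mean_curvature _ _ gamma alpha p HI HJ hgamma halpha himm)
    as Hmc.
  split.
  - intros Hmin.
    assert (Hk : forall t s, Rbar_open_interval a2 b2 t -> Rbar_open_interval a1 b1 s ->
      Legendre_curvature 1 gamma s = 0 /\ Legendre_curvature (-1) alpha t = 0).
    { intros t s Ht Hs.
      specialize (Hmin (t, s) (conj Ht Hs)).
      destruct (Hmc (t, s) (conj Ht Hs)) as (HE & HPP & HTT & HTP & HH).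
      cbn [fst snd] in *.
      pose proof (herm_sym_eq0 _ _ _ HTP) as HPT.
      set (E := Cmod (fst (gamma s)) ^ 2 + Cmod (fst (alpha t)) ^ 2) in *.
      rewrite Hmin in HH; symmetry in HH; apply scal_eq_0_C2 in HH.
      2:{ apply Rmult_integral_contrapositive_currified; [ lra | ].
          apply Rinv_neq_0_compat; lra. }
      assert (H0 : forall r, Cmult Ci (RtoC (r * E)) = RtoC 0 -> r = 0).
      { intros r Hr; apply Ci_mult_real_eq0, Rmult_integral in Hr; tauto. }
      split; apply H0; rewrite RtoC_mult.
      - apply (f_equal (fun z => herm 1 z (partial true (product_map alpha gamma) (t, s))))
          in HH.
        rewrite herm_zero_l, herm_plus_l, !herm_cscal_l, HPP, HTP in HH.
        rewrite <- HH; ring.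
      - apply (f_equal (fun z => herm 1 z (partial false (product_map alpha gamma) (t, s))))
          in HH.
        rewrite herm_zero_l, herm_plus_l, !herm_cscal_l, HTT, HPT in HH.
        rewrite <- HH; ring. }
    destruct (Rbar_open_interval_nonempty _ _ hI1) as [s0 Hs0].
    destruct (Rbar_open_interval_nonempty _ _ hI2) as [t0 Ht0].
    split; [ intros s Hs; apply (Hk t0 s) | intros t Ht; apply (Hk t s0) ]; auto.
  - intros [Hk Hkappa] p [Ht Hs].
    destruct (Hmc p (conj Ht Hs)) as (_ & _ & _ & _ & HH).
    rewrite HH, (Hk _ Hs), (Hkappa _ Ht), !Cmult_0_r, !cscal_0, plus_zero_l.
    apply (scal_zero_r (V := C2)).
Qed.
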